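(* Let $\mathfrak{F}$ and $\mathfrak{G}$ be (Kripke or descriptive) frames with $\mathfrak{G}$ a substructure of $\mathfrak{F}$. If $\mathfrak{F}\models\beta(\mathfrak{N})$ for some finite rooted $n$-model $\mathfrak{N}$, then $\mathfrak{G}\models\beta(\mathfrak{N})$. In other words, validity of formulas in $\mathsf{B}$ is preserved by substructures.
   Context: Formulas are built from propositional variables and $\bot$ by $\wedge,\vee,\to$. A Kripke frame is $(W,R)$ with $W\neq\emptyset$ and $R$ a partial order. A general frame is $(W,R,\mathcal P)$ with $(W,R)$ a Kripke frame and $\mathcal P$ a set of upsets containing $\emptyset,W$, closed under $\cup,\cap$ and $U_0\to U_1:=\{w\mid \forall v\,(wRv\text{ and }v\in U_0\text{ imply }v\in U_1)\}$. It is refined if $\neg wRv$ implies there is $U\in\mathcal P$ with $w\in U$, $v\notin U$; it is compact if every $\mathcal X\subseteq\mathcal P\cup\{W\setminus U\mid U\in\mathcal P\}$ with the finite intersection property has $\bigcap\mathcal X\ne\emptyset$; it is descriptive if it is refined and compact. A Kripke frame is regarded as a general frame with $\mathcal P$ the set of all upsets. A model is a (Kripke or descriptive) frame with a valuation $V$ such that $V(p)\in\mathcal P$ for each variable $p$; truth at a world is the standard intuitionistic Kripke semantics. $\mathfrak F\models\varphi$ means $\varphi$ is true at all worlds of all models on $\mathfrak F$. An $n$-model is a model whose valuation is restricted to $n$ fixed variables $p_1,\dots,p_n$. A (Kripke or descriptive) frame $\mathfrak G=(W',R',\mathcal P')$ is a substructure of $\mathfrak F=(W,R,\mathcal P)$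 iff $W'\subseteq W$ and $R'=R\upharpoonright W'$ (no relation between $\mathcal P'$ and $\mathcal P$ is required). For a finite $n$-model $\mathfrak N$ and a world $w$, let $prop(w)$ be the set of those $p_i$ ($1\le i\le n$) true at $w$ and $notprop(w)$ the set of those $p_i$ not true at $w$. The formula $\beta(w)$ is defined by induction on the depth of $w$ by $\beta(w):=\bigwedge prop(w)\to\bigvee notprop(w)\vee\bigvee_{i=1}^k\beta(w_i)$, where $w_1,\dots,w_k$ are all immediate successors of $w$ (for $w$ maximal, $\beta(w):=\bigwedge prop(w)\to\bigvee notprop(w)$). Empty conjunctions are true, empty disjunctions are $\bot$. If $\mathfrak N$ is rooted with root $r$, $\beta(\mathfrak N):=\beta(r)$. $\mathsf B$ is the set of all formulas $\beta(w)$ for $w$ a node of some finite $n$-model, for some $n$. *)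

(* Defs.v *)
From HB Require Import structures.
From mathcomp Require Import all_boot all_order.
From mathcomp Require Import boolp classical_sets functions cardinality.

Set Implicit Arguments.
Unset Strict Implicit.
Unset Printing Implicit Defensive.

Import Order.TTheory.

Local Open Scope classical_set_scope.

Inductive formula : Type :=
| Var of nat
| Bot
| And of formula & formula
| Or of formula & formula
| Imp of formula & formula.

Definition Top : formula := Imp Bot Bot.

Fixpoint bigAnd (s : seq formula) : formula :=
  match s with
  | [::] => Top
  | [:: a] => a
  | a :: s' => And a (bigAnd s')
  end.

Fixpoint bigOr (s : seq formula) : formula :=
  match s with
  | [::] => Bot
  | [:: a] => a
  | a :: s' => Or a (bigOr s')
  end.

(** Frames live on subsets of an ambient type [T], so that inclusion of the
    carriers of two frames can be stated literally.  The accessibility relation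
    is a subset of [worlds * worlds]. *)
Record kripke_frame (T : Type) := KripkeFrame {
  worlds : set T;
  acc : T -> T -> Prop;
  worlds_neq0 : worlds !=set0;
  acc_worlds : forall w v, acc w v -> worlds w /\ worlds v;
  acc_refl : forall w, worlds w -> acc w w;
  acc_trans : forall u v w, acc u v -> acc v w -> acc u w;
  acc_anti : forall w v, acc w v -> acc v w -> w = v
}.

Definition upset T (K : kripke_frame T) (U : set T) : Prop :=
  U `<=` worlds K /\ forall w v, acc K w v -> U w -> U v.

Definition set_imp T (K : kripke_frame T) (U0 U1 : set T) : set T :=
  [set w | worlds K w /\ forall v, acc K w v -> U0 v -> U1 v].

Record general_frame (T : Type) := GeneralFrame {
  kframe :> kripke_frame T;
  adm : set (set T);
  adm_upset : forall U, adm U -> upset kframe U;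
  adm_set0 : adm set0;
  adm_worlds : adm (worlds kframe);
  adm_setU : forall U0 U1, adm U0 -> adm U1 -> adm (U0 `|` U1);
  adm_setI : forall U0 U1, adm U0 -> adm U1 -> adm (U0 `&` U1);
  adm_imp : forall U0 U1, adm U0 -> adm U1 -> adm (set_imp kframe U0 U1)
}.

Definition refined T (F : general_frame T) : Prop :=
  forall w v, worlds F w -> worlds F v -> ~ acc F w v ->
    exists U, [/\ adm F U, U w & ~ U v].

(** Intersections are taken inside [worlds F], so the empty family has
    intersection [worlds F]. *)
Definition finite_intersection_property T (F : general_frame T)
    (X : set (set T)) : Prop :=
  forall Y, Y `<=` X -> finite_set Y ->
    (worlds F `&` \bigcap_(U in Y) U) !=set0.

Definition compact_frame T (F : general_frame T) : Prop :=
  forall X : set (set T),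
    X `<=` adm F `|` [set worlds F `\` U | U in adm F] ->
    finite_intersection_property F X ->
    (worlds F `&` \bigcap_(U in X) U) !=set0.

Definition descriptive T (F : general_frame T) : Prop :=
  refined F /\ compact_frame F.

Definition is_kripke T (F : general_frame T) : Prop :=
  adm F = [set U | upset F U].

Definition kripke_or_descriptive T (F : general_frame T) : Prop :=
  is_kripke F \/ descriptive F.

Definition valuation T (F : general_frame T) (V : nat -> set T) : Prop :=
  forall p, adm F (V p).

Fixpoint forces T (K : kripke_frame T) (V : nat -> set T) (w : T)
    (phi : formula) : Prop :=
  match phi with
  | Var p => V p w
  | Bot => False
  | And a b => forces K V w a /\ forces K V w b
  | Or a b => forces K V w a \/ forces K V w b
  | Imp a b => forall v, acc K w v -> forces K V v a -> forces K V v b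
  end.

Definition valid T (F : general_frame T) (phi : formula) : Prop :=
  forall V, valuation F V -> forall w, worlds F w -> forces F V w phi.

Definition substructure T (G F : general_frame T) : Prop :=
  worlds G `<=` worlds F /\
  forall w v, acc G w v <-> [/\ worlds G w, worlds G v & acc F w v].

(** The variables [p_1, ..., p_n] are [Var 0, ..., Var n.-1].  Every upset of a
    finite refined frame is admissible, so a finite model, Kripke or
    descriptive, is just a finite poset with upset valuations. *)
Record finite_model (n : nat) := FiniteModel {
  fm_disp : Order.disp_t;
  node :> finPOrderType fm_disp;
  fm_val : 'I_n -> {set node};
  fm_val_up : forall i (w v : node),
    (w <= v)%O -> w \in fm_val i -> v \in fm_val i
}.

Record rooted_finite_model (n : nat) := RootedFiniteModel {
  rfm_model :> finite_model n;
  root : rfm_model;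
  root_le : forall w : rfm_model, (root <= w)%O
}.

Section Beta.
Variables (n : nat) (N : finite_model n).
Implicit Types w v : N.

Definition prop w : seq formula :=
  [seq Var (val i) | i <- enum 'I_n & w \in fm_val N i].

Definition notprop w : seq formula :=
  [seq Var (val i) | i <- enum 'I_n & w \notin fm_val N i].

Definition immediate_succ w v : bool :=
  (w < v)%O && ~~ [exists u : N, (w < u)%O && (u < v)%O].

Definition immediate_succs w : seq N :=
  [seq v <- enum N | immediate_succ w v].

Definition beta_step (b : N -> formula) w : formula :=
  Imp (bigAnd (prop w))
    (if immediate_succs w is [::] then bigOr (notprop w)
     else Or (bigOr (notprop w)) (bigOr [seq b v | v <- immediate_succs w])).

Fixpoint beta_rec (k : nat) w : formula :=
  if k is k'.+1 then beta_step (beta_rec k') w else Bot.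

(** The fuel [#|N|] exceeds the depth of every node, so that the defining
    equation [betaE] below holds; it determines [beta]. *)
Definition beta w : formula := beta_rec #|N| w.

Lemma beta_recE k l w :
  #|[pred v : N | (w < v)%O]| < k -> #|[pred v : N | (w < v)%O]| < l ->
  beta_rec k w = beta_rec l w.
Proof.
elim: k l w => [|k IH] [|l] w //= wk wl.
rewrite /beta_step; suff -> : [seq beta_rec k v | v <- immediate_succs w] =
  [seq beta_rec l v | v <- immediate_succs w] by [].
apply/eq_in_map => v; rewrite mem_filter => /andP[/andP[wv _] _].
have lt : #|[pred u : N | (v < u)%O]| < #|[pred u : N | (w < u)%O]|.
  apply: proper_card; apply/properP; split.
    by apply/fintype.subsetP => u; rewrite !inE; apply: lt_trans.
  by exists v; rewrite !inE ?ltxx.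
by apply: IH; apply: leq_trans lt _.
Qed.

Lemma betaE w : beta w = beta_step beta w.
Proof.
have fuel v : #|[pred u : N | (v < u)%O]| < #|N|.
  apply: proper_card; apply/properP; split.
    by apply/fintype.subsetP.
  by exists v; rewrite !inE ?ltxx.
by rewrite /beta (@beta_recE #|N| #|N|.+1) // (leq_trans (fuel w)).
Qed.

End Beta.

Definition beta_model n (N : rooted_finite_model n) : formula := beta (root N).

Definition classB : set formula :=
  [set phi | exists (n : nat) (N : finite_model n) (w : N), phi = beta w].

(* Main.v *)
Require Import Defs.
From mathcomp Require Import all_boot all_order.
From mathcomp Require Import boolp classical_sets.
From Stdlib Require List.

(** Formulas in [classB] are NNIL: no implication is nested to the left of an
    implication.  The refutation of an NNIL formula at a world is witnessed by
    finitely many worlds: it survives in any model that keeps the order between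
    these worlds and the truth of variables at them.  When [G] is a substructure
    of a refined frame [F], the finitely many worlds witnessing a refutation on
    [G] have the same order in [F], and finite unions of finite intersections of
    separating admissible upsets of [F] reproduce the valuation on them. *)

Set Implicit Arguments.
Unset Strict Implicit.
Unset Printing Implicit Defensive.

Local Open Scope classical_set_scope.

(** [Top] is [Imp Bot Bot], hence the exception. *)
Fixpoint imp_free (phi : formula) : bool :=
  match phi with
  | Var _ | Bot => true
  | And a b | Or a b => imp_free a && imp_free b
  | Imp Bot Bot => true
  | Imp _ _ => false
  end.

Fixpoint nnil (phi : formula) : bool :=
  match phi with
  | Var _ | Bot => true
  | And a b | Or a b => nnil a && nnil b
  | Imp a b => imp_free a && nnil b
  end.

Lemma imp_free_bigAnd (s : seq formula) : all imp_free s -> imp_free (bigAnd s).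
Proof.
elim: s => [//|a [|b s] IH] /=; first by rewrite andbT.
by move=> /andP[-> /IH].
Qed.

Lemma nnil_bigOr (s : seq formula) : all nnil s -> nnil (bigOr s).
Proof.
elim: s => [//|a [|b s] IH] /=; first by rewrite andbT.
by move=> /andP[-> /IH].
Qed.

Lemma nnil_beta n (N : finite_model n) (w : N) : nnil (beta w).
Proof.
(* Induction on the fuel, whatever its value: at zero the formula is [Bot], which is NNIL. *)
rewrite /beta; elim: #|N| w => [//|k IH] w /=.
have -> : imp_free (bigAnd (prop w)).
  by apply: imp_free_bigAnd; rewrite all_map; apply/allP.
have notpropP : nnil (bigOr (notprop w)).
  by apply: nnil_bigOr; rewrite all_map; apply/allP.
have succP : nnil (bigOr [seq beta_rec k v | v <- immediate_succs w]).
  by apply: nnil_bigOr; rewrite all_map; apply/allP => v _; apply: IH.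
by case: (immediate_succs w) succP => [|v vs] succP //=; rewrite notpropP.
Qed.

(** Without implications other than [Top], truth at [x] never looks at another world, so the two
    frames may be unrelated. *)
Lemma forces_imp_free T (K K' : kripke_frame T) (V V' : nat -> set T) (x : T)
    (phi : formula) :
  imp_free phi -> (forall p, V' p x <-> V p x) ->
  forces K V x phi <-> forces K' V' x phi.
Proof.
move=> + VV'; elim: phi => [p|//|a IHa b IHb|a IHa b IHb|a _ b _] /=.
- by move=> _; split => /VV'.
- by move=> /andP[/IHa ? /IHb ?]; tauto.
- by move=> /andP[/IHa ? /IHb ?]; tauto.
- by case: a => //; case: b.
Qed.

(** A failing implication is witnessed by a single successor, where the antecedent depends on
    variables alone; recursion on the consequent collects the list. Extra pairs in [acc F] do no
    harm, so the order need only be preserved from [G] to [F]. *)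
Lemma nnil_refutation_finite T (G : kripke_frame T) (V : nat -> set T) (x : T)
    (phi : formula) :
  nnil phi -> worlds G x -> ~ forces G V x phi ->
  exists s : seq T, (forall y, List.In y s -> worlds G y) /\
    forall (F : kripke_frame T) (V' : nat -> set T),
      (forall y z, List.In y s -> List.In z s -> acc G y z -> acc F y z) ->
      (forall p y, List.In y s -> V' p y <-> V p y) ->
      ~ forces F V' x phi.
Proof.
elim: phi x => [p|//|a IHa b IHb|a IHa b IHb|a _ b IHb] x /=.
- move=> _ Gx nVx; exists [:: x]; split=> [y [<-|[]] //|F V' _ VV'].
  by rewrite VV' //=; left.
- by move=> _ _ _; exists [::]; split=> // F V' _ _ [].
- move=> /andP[na nb] Gx /not_andP[nfa|nfb].
  + have [s [Gs sP]] := IHa x na Gx nfa.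
    by exists s; split=> // F V' sF VV' [fa _]; apply: sP fa.
  + have [s [Gs sP]] := IHb x nb Gx nfb.
    by exists s; split=> // F V' sF VV' [_ fb]; apply: sP fb.
- move=> /andP[na nb] Gx /not_orP[nfa nfb].
  have [s [Gs sP]] := IHa x na Gx nfa.
  have [t [Gt tP]] := IHb x nb Gx nfb.
  exists (s ++ t); split=> [y /List.in_app_iff[/Gs|/Gt] //|F V' stF VV' [fa|fb]].
  + apply: (sP F V') => // [y z ys zs|p y ys].
      by apply: stF; apply/List.in_app_iff; left.
    by apply: VV'; apply/List.in_app_iff; left.
  + apply: (tP F V') => // [y z yt zt|p y yt].
      by apply: stF; apply/List.in_app_iff; right.
    by apply: VV'; apply/List.in_app_iff; right.
- move=> /andP[ia nb] Gx /existsNP[y /not_implyP[xy /not_implyP[fa nfb]]].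
  have [_ Gy] := acc_worlds xy.
  have [s [Gs sP]] := IHb y nb Gy nfb.
  (* Both ends are listed so that [acc F x y] holds; listing [y] also keeps the antecedent true
     there. *)
  exists [:: x, y & s]; split=> [z [<-|[<-|/Gs]] //|F V' sF VV' fab].
  apply: (sP F V') => [z t zs ts|p z zs|].
  + by apply: sF; right; right.
  + by apply: VV'; right; right.
  apply: fab; first by apply: sF xy; [left | right; left].
  have agree p : V' p y <-> V p y by apply: VV'; right; left.
  exact: (proj1 (forces_imp_free G F ia agree) fa).
Qed.

Lemma kripke_or_descriptive_refined T (F : general_frame T) :
  kripke_or_descriptive F -> refined F.
Proof.
(* In a Kripke frame the principal upset of [w] is admissible and omits [v]. *)
move=> [admE|[] //] w v Fw Fv nwv; exists [set u | acc F w u]; split=> //.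
- rewrite admE; split=> [u wu|u t ut wu].
    by have [] := acc_worlds wu.
  exact: acc_trans wu ut.
- exact: acc_refl.
Qed.

(** [U] is the union, over the [x] in [s] with [P x], of the intersections, over the [y] in [t]
    outside [P], of admissible sets containing [x] but not [y]. *)
Lemma refined_separation T (F : general_frame T) (P : set T) (s t : seq T) :
  refined F ->
  (forall x, List.In x s -> worlds F x) ->
  (forall y, List.In y t -> worlds F y) ->
  (forall x y, List.In x s -> List.In y t -> acc F x y -> P x -> P y) ->
  exists U, [/\ adm F U, forall x, List.In x s -> P x -> U x &
                forall y, List.In y t -> U y -> P y].
Proof.
move=> Fref + Ft; elim: s => [|x s IH] Fs up.
  by exists set0; split=> //; apply: adm_set0.
have [U [admU sU tU]] : exists U, [/\ adm F U,
    forall x, List.In x s -> P x -> U x & forall y, List.In y t -> U y -> P y].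
  by apply: IH => [z zs|z y zs]; [apply: Fs; right | apply: up; right].
have Fx : worlds F x by apply: Fs; left.
have [Px|nPx] := pselect (P x); last first.
  by exists U; split=> // z [<- //|]; apply: sU.
have xt y : List.In y t -> acc F x y -> P y.
  by move=> yt xy; apply: up xy Px => //; left.
suff [W [admW Wx tW]] : exists W, [/\ adm F W, W x &
    forall y, List.In y t -> W y -> P y].
  exists (U `|` W); split; first exact: adm_setU.
  - by move=> z [<- _|zs Pz]; [right | left; apply: sU].
  - by move=> y yt [/(tU _ yt)|/(tW _ yt)].
(* With [x] fixed, the intersection is built along [t], starting from [worlds F]. *)
elim: t Ft xt {IH up U admU sU tU} => [|y t IH] Ft xt.
  by exists (worlds F); split=> //; apply: adm_worlds.
have [W [admW Wx tW]] : exists W, [/\ adm F W, W x &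
    forall y, List.In y t -> W y -> P y].
  by apply: IH => z zt; [apply: Ft | apply: xt]; right.
have [Py|nPy] := pselect (P y).
  by exists W; split=> // z [<- //|]; apply: tW.
have [|xy|U [admU Ux nUy]] := Fref x y Fx; first by apply: Ft; left.
  by apply: nPy; apply: xt xy; left.
exists (U `&` W); split=> //; first exact: adm_setI.
by move=> z [<- [/nUy]//|zt [_]]; apply: tW.
Qed.

Lemma nnil_valid_substructure T (F G : general_frame T) (phi : formula) :
  refined F -> substructure G F -> nnil phi -> valid F phi -> valid G phi.
Proof.
move=> Fref [GF accGF] nphi Fphi V admV x Gx; apply: contrapT => nf.
have [s [Gs sP]] := nnil_refutation_finite nphi Gx nf.
have Fs y : List.In y s -> worlds F y by move=> /Gs /GF.
have sep p : exists U, [/\ adm F U, forall y, List.In y s -> V p y -> U y &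
    forall y, List.In y s -> U y -> V p y].
  (* Both lists are [s], so [U] agrees with [V p] on it. Between worlds of [G] the order of [F] is
     that of [G], along which [V p] is closed. *)
  apply: refined_separation => // y z /Gs Gy /Gs Gz yz.
  by have [_] := adm_upset (admV p); apply; apply/accGF.
have [V' V'P] := choice sep.
apply: (sP F V').
- by move=> y z _ _ /accGF[].
- by move=> p y ys; have [_ ? ?] := V'P p; split; auto.
- by apply: Fphi; [move=> p; have [] := V'P p | apply: GF].
Qed.

Theorem corollary3p8 (T : Type) (F G : general_frame T)
    (hF : kripke_or_descriptive F) (hG : kripke_or_descriptive G)
    (hGF : substructure G F) :
  (forall (n : nat) (N : rooted_finite_model n),
     valid F (beta_model N) -> valid G (beta_model N)) /\
  (forall phi : formula, classB phi -> valid F phi -> valid G phi).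
Proof.
have Fref := kripke_or_descriptive_refined hF.
split=> [n N|phi [n [N [w ->]]]];
  exact: (nnil_valid_substructure Fref hGF (nnil_beta _)).
Qed.
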